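(* For any irreducible homogeneous polynomial $P$ with complex coefficients, $$\overline{dc}(P)\ \geq\ \frac{\dim Z(P)^*+1}{2}.$$
   Context: For an irreducible homogeneous polynomial $P$ of degree $m\ge1$ in $M$ variables, $Z(P)\subset\mathbb P^{M-1}$ is the hypersurface it defines, and the dual variety $Z(P)^*$ is the Zariski closure, in the dual projective space, of the set of tangent hyperplanes to $Z(P)$ (at smooth points). $M_n(\mathbb C)$ is the space of complex $n\times n$ matrices, $S^n(M_n(\mathbb C))^*$ the space of homogeneous polynomials of degree $n$ on it, $\det_n$ the determinant, and $\overline{GL_{n^2}\cdot[\det_n]}\subset\mathbb P(S^n(M_n(\mathbb C))^* )$ the Zariski closure of the orbit of $[\det_n]$ under $GL_{n^2}=GL(M_n(\mathbb C))$ acting by linear changes of variables. $\overline{dc}(P)$ is the smallest $n\ge m$ such that $[\ell^{n-m}P]\in\overline{GL_{n^2}\cdot[\det_n]}$, where $\ell$ is a linear coordinate on $\mathbb C$ and $\ell^{n-m}P$ is viewed as a degree $n$ form on $M_n(\mathbb C)$ via a linear inclusion $\mathbb C\oplus\mathbb C^M\subset M_n(\mathbb C)$, i.e. by taking $\ell$ and the $M$ variables of $P$ to be linearly independent linear forms on $M_n(\mathbb C)$ (if $n=m$, $\ell$ does not occur and only an inclusion $\mathbb C^M\subset M_n(\mathbb C)$ is needed). The condition does not depend on the choice of the inclusion. *)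

(* Defs.v *)
(* The complex field is R[i] with R : realType. *)
From HB Require Import structures.
From mathcomp Require Export all_boot all_order all_algebra.
From mathcomp Require Export mpoly complex.
From mathcomp Require Export boolp classical_sets reals constructive_ereal ereal.

Set Implicit Arguments.
Unset Strict Implicit.
Unset Printing Implicit Defensive.

Import GRing.Theory.

Local Open Scope ring_scope.
Local Open Scope classical_set_scope.

Section Polynomials.
Variable R : realType.
Local Notation C := R[i].

Definition irreducible_mpoly N (P : {mpoly C[N]}) : Prop :=
  [/\ P != 0, P \isn't a GRing.unit &
      forall A B : {mpoly C[N]}, P = A * B ->
        A \is a GRing.unit \/ B \is a GRing.unit].

Definition eval_at N (F : {mpoly C[N]}) (v : 'rV[C]_N) : C :=
  F.@[fun i => v 0 i].

Definition lin_form N (a : 'rV[C]_N) : {mpoly C[N]} :=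
  \sum_(j < N) a 0 j *: 'X_j.

(* The linear substitution replacing 'X_i by the linear form of row i of A,
   i.e. the pullback of P along the linear map C^N -> C^M of matrix A. *)
Definition lin_subst M N (A : 'M[C]_(M, N)) (P : {mpoly C[M]}) :
    {mpoly C[N]} :=
  P \mPo [tuple lin_form (row i A) | i < M].

End Polynomials.

(* A set S of vectors of C^k stands for the set of points [v] of P^(k-1) with
   v a nonzero element of S; the sets produced by [pclosure] contain, with v,
   every nonzero multiple of v, and never 0. *)
Section ProjectiveZariski.
Variables (R : realType) (k : nat).
Local Notation C := R[i].
Implicit Types X Z S A B : set 'rV[C]_k.

Definition pclosure S : set 'rV[C]_k :=
  [set v | v != 0 /\
     forall (d : nat) (F : {mpoly C[k]}), F \is d.-homog ->
       (forall w, S w -> eval_at F w = 0) -> eval_at F v = 0].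

Definition pclosed Z : Prop := pclosure Z = Z.

Definition pirreducible Z : Prop :=
  Z !=set0 /\
  forall A B, pclosed A -> pclosed B -> Z `<=` A `|` B ->
    Z `<=` A \/ Z `<=` B.

(* There are irreducible closed sets Z_0 < Z_1 < ... < Z_d inside X. *)
Definition irreducible_chain X (d : nat) : Prop :=
  exists Z : nat -> set 'rV[C]_k,
    (forall i, (i <= d)%N ->
       [/\ pclosed (Z i), pirreducible (Z i) & Z i `<=` X]) /\
    (forall i, (i < d)%N -> Z i `<` Z i.+1).

(* Krull dimension of a closed X; it is -oo exactly when X is empty. *)
Definition pdim X : \bar R :=
  ereal_sup [set (d%:R : R)%:E | d in irreducible_chain X].

End ProjectiveZariski.

Section DualVariety.
Variables (R : realType) (M : nat).
Local Notation C := R[i].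

Definition gradient (P : {mpoly C[M]}) (x : 'rV[C]_M) : 'rV[C]_M :=
  \row_i eval_at (P^`M(i)) x.

(* Row vectors y also serve as homogeneous coordinates on the dual space, y
   being the hyperplane {v | \sum_i y_i v_i = 0}. As P is irreducible, hence
   reduced, the smooth points of Z(P) are those where the gradient does not
   vanish, and the gradient is then the tangent hyperplane. *)
Definition tangent_hyperplanes (P : {mpoly C[M]}) : set 'rV[C]_M :=
  [set y | exists x : 'rV[C]_M,
     [/\ x != 0, eval_at P x = 0, gradient P x != 0 &
         exists2 c : C, c != 0 & y = c *: gradient P x]].

Definition dual_variety (P : {mpoly C[M]}) : set 'rV[C]_M :=
  pclosure (tangent_hyperplanes P).

End DualVariety.

Section BorderDeterminantalComplexity.
Variable R : realType.
Local Notation C := R[i].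

Definition monomial (N d : nat) : finType :=
  {u : 'X_{1..N < d.+1} | mdeg u == d}.

(* The coordinates of a form of degree d in N variables: its coefficients on
   the monomials of degree d. *)
Definition form_coords N d (F : {mpoly C[N]}) : 'rV[C]_#|{: monomial N d}| :=
  \row_(i < #|{: monomial N d}|) F@_(val (val (enum_val i))).

(* The coordinate functions on 'M[C]_n are the variables indexed by
   [mxvec_index i j], in accordance with [mxvec]. *)
Definition det_form n : {mpoly C[n * n]} :=
  \det (\matrix_(i < n, j < n) 'X_(mxvec_index i j)).

Definition det_orbit n : set 'rV[C]_#|{: monomial (n * n) n}| :=
  [set form_coords n (lin_subst g (det_form n)) |
     g in [set g : 'M[C]_(n * n) | g \in unitmx]].

(* Q is l ^ (n - m) * P for a linear inclusion of C + C^M in 'M[C]_n; for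
   n = m the form l does not occur and is left unconstrained. *)
Definition is_padding M m n (P : {mpoly C[M]}) (Q : {mpoly C[n * n]}) : Prop :=
  exists (l : 'rV[C]_(n * n)) (A : 'M[C]_(M, n * n)),
    (if n == m then row_free A else row_free (col_mx l A)) /\
    Q = lin_form l ^+ (n - m) * lin_subst A P.

Definition border_det_size M m (P : {mpoly C[M]}) (n : nat) : Prop :=
  (m <= n)%N /\
  exists2 Q : {mpoly C[n * n]},
    is_padding m P Q & pclosure (@det_orbit n) (form_coords n Q).

(* The smallest such n; the infimum of the empty set would be +oo. *)
Definition border_dc M m (P : {mpoly C[M]}) : \bar R :=
  ereal_inf [set (n%:R : R)%:E | n in border_det_size m P].

End BorderDeterminantalComplexity.

(* Main.v *)
(* If a chain Z_0 < ... < Z_d of irreducible closed subsets of Z(P)^* has d >= 2n,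
   forms b_i vanishing on Z_(i-1) but not on Z_i are 2n + 1 forms, of the same
   degree after taking powers, that are algebraically independent on Z(P)^*.
   On the other hand the gradient of det_n on {det_n = 0} is the adjugate, of rank
   one modulo det_n, so it depends on 2n parameters: counting dimensions, for
   every g some nonzero homogeneous G, of a degree D that does not depend on g,
   makes G(b_i(grad Q)) divisible by Q = det_n o g.  The existence of G is the
   linear dependence of the forms b^a(grad Q), |a| = D, and x^u Q, hence a closed
   condition on Q, and it still holds for Q = l^(n-m) P.  Where P = 0 and
   l = 1, the gradient of Q restricts to that of P, so that G(b_i) vanishes on
   Z(P)^*, a contradiction.  *)
Require Import Defs.
From mathcomp Require Import all_boot all_order all_algebra.
From mathcomp Require Import mpoly complex.
From mathcomp Require Import perm zify ring.
From mathcomp Require Import boolp classical_sets reals constructive_ereal ereal.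

Set Implicit Arguments.
Unset Strict Implicit.
Unset Printing Implicit Defensive.

Import Order.TTheory GRing.Theory Num.Theory.

Local Open Scope ring_scope.

(** * Homogeneous polynomials and composition *)

Lemma mpoly_alg_ind (K : comNzRingType) N (S : {mpoly K[N]} -> Prop) :
  (forall c, S c%:MP) -> (forall i, S 'X_i) ->
  (forall p q, S p -> S q -> S (p + q)) ->
  (forall p q, S p -> S q -> S (p * q)) -> forall p, S p.
Proof.
move=> SC SX SD SM p; rewrite (mpolyE p).
elim/big_ind: _ => [|//|m _]; first by rewrite -mpolyC0; apply: SC.
rewrite -mul_mpolyC mpolyXE_id; apply: (SM _ _ (SC _)).
elim/big_ind: _ => [|//|i _]; first by rewrite -mpolyC1; apply: SC.
by elim: (m i) => [|e IHe]; rewrite ?expr0 -?mpolyC1 ?exprS //; apply: SM.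
Qed.

Lemma dhomog_mdeg (K : comNzRingType) N (p : {mpoly K[N]}) d m :
  p \is d.-homog -> m \in msupp p -> mdeg m = d.
Proof. by move=> hp; apply: dhomog_mf. Qed.

Lemma dhomog_coeff0 (K : comNzRingType) N (p : {mpoly K[N]}) d m :
  p \is d.-homog -> mdeg m != d -> p@_m = 0.
Proof. by move=> hp; apply: dhomog_nemf_coeff. Qed.

Lemma dhomog_Xi (K : comNzRingType) N (i : 'I_N) :
  ('X_i : {mpoly K[N]}) \is 1.-homog.
Proof. by rewrite dhomogX; apply/eqP/mdeg1. Qed.

Lemma comp_mpolyXi (K : comNzRingType) a b i (t : a.-tuple {mpoly K[b]}) :
  'X_i \mPo t = tnth t i.
Proof. by rewrite comp_mpolyXU -tnth_nth. Qed.

Lemma mderiv_Xi (K : comNzRingType) N (a b : 'I_N) :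
  ('X_a : {mpoly K[N]})^`M(b) = (a == b)%:R.
Proof.
rewrite mderivX mnm1E; have [<-|] := eqVneq a b; last by rewrite scale0r.
rewrite scale1r -[RHS]mpolyX0; congr 'X_[_].
by apply/mnmP => l; rewrite mnmBE subnn mnm0E.
Qed.

Lemma dhomog_bigprod (K : comNzRingType) N (I : Type) (r : seq I)
    (F : I -> {mpoly K[N]}) (d : I -> nat) :
  (forall i, F i \is (d i).-homog) ->
  \prod_(i <- r) F i \is (\sum_(i <- r) d i)%N.-homog.
Proof.
move=> hF; elim: r => [|i r IHr]; rewrite ?big_nil ?dhomog1 // !big_cons.
exact: dhomogM.
Qed.

Section Composition.
Variables (K : comNzRingType) (a b : nat).
Implicit Types (p : {mpoly K[a]}) (t : a.-tuple {mpoly K[b]}).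

Lemma comp_mpolyA c p t (u : b.-tuple {mpoly K[c]}) :
  (p \mPo t) \mPo u = p \mPo [tuple tnth t i \mPo u | i < a].
Proof.
elim/mpoly_alg_ind: p => [x|i|p q IHp IHq|p q IHp IHq].
- by rewrite !comp_mpolyC.
- by rewrite !comp_mpolyXi tnth_mktuple.
- by rewrite !rmorphD /= IHp IHq.
- by rewrite !rmorphM /= IHp IHq.
Qed.

Lemma mderiv_comp p t j :
  (p \mPo t)^`M(j) = \sum_i (p^`M(i) \mPo t) * (tnth t i)^`M(j).
Proof.
elim/mpoly_alg_ind: p => [x|k|p q IHp IHq|p q IHp IHq].
- rewrite comp_mpolyC mderivC big1 // => i _.
  by rewrite mderivC comp_mpoly0 mul0r.
- rewrite comp_mpolyXi (bigD1 k) //= big1 ?addr0 => [|i ik].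
    by rewrite mderiv_Xi eqxx comp_mpoly1 mul1r.
  by rewrite mderiv_Xi eq_sym (negPf ik) comp_mpoly0 mul0r.
- rewrite comp_mpolyD mderivD IHp IHq -big_split; apply: eq_bigr => i _ /=.
  by rewrite mderivD comp_mpolyD mulrDl.
- rewrite rmorphM /= mderivM IHp IHq mulr_suml mulr_sumr -big_split.
  apply: eq_bigr => i _ /=; rewrite mderivM comp_mpolyD !rmorphM /= mulrDl.
  by rewrite mulrAC !mulrA.
Qed.

Lemma dhomog_comp p t d e :
  p \is d.-homog -> (forall i, tnth t i \is e.-homog) ->
  p \mPo t \is (d * e)%N.-homog.
Proof.
move=> hp ht; rewrite comp_mpolyEX big_seq.
apply: rpred_sum => m /(dhomog_mdeg hp) md; rewrite comp_mpolyX.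
apply: dhomogZ; have <- : (\sum_i e * m i)%N = (d * e)%N.
  by rewrite -md mdegE big_distrl; apply: eq_bigr => i _; rewrite mulnC.
by apply: dhomog_bigprod => i; apply: dhomogMn.
Qed.

Lemma dhomog_mderiv p d i : p \is d.-homog -> p^`M(i) \is d.-1.-homog.
Proof.
move=> hp; apply/dhomogP => m; rewrite mcoeff_msupp mcoeff_deriv.
apply: contraNeq => md; suff -> : p@_(m + U_(i)) = 0 by rewrite mul0rn.
apply: dhomog_coeff0 hp _; rewrite mdegD mdeg1 addn1.
by apply: contraNneq md => <-.
Qed.

Lemma meval_dhomog p d c v :
  p \is d.-homog -> p.@[fun i => c * v i] = c ^+ d * p.@[v].
Proof.
move=> hp; rewrite !mevalE mulr_sumr big_seq [RHS]big_seq.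
apply: eq_bigr => m /(dhomog_mdeg hp) md; rewrite mulrCA; congr (_ * _).
rewrite -md mdegE -prodrXr -big_split; apply: eq_bigr => i _.
by rewrite exprMn.
Qed.

End Composition.

(** * Polynomial families and linear dependence *)

Lemma sum_enum_val (V : nmodType) (I : finType) (F : I -> V) :
  \sum_i F i = \sum_(p < #|I|) F (enum_val p).
Proof. by rewrite -(big_enum_val F) /=; apply: eq_bigl. Qed.

Section LinearDependence.
Variables (K : fieldType) (I J : finType) (a : I -> J -> K).

Definition dependent : Prop :=
  exists c : I -> K, (exists i, c i != 0) /\ forall j, \sum_i c i * a i j = 0.

Definition coef_mx : 'M[K]_(#|I|, #|J|) :=
  \matrix_(p, q) a (enum_val p) (enum_val q).

Lemma dependent_not_row_free : ~~ row_free coef_mx -> dependent.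
Proof.
rewrite -kermx_eq0 -nz_row_eq0 => nz.
have /sub_kermxP/matrixP eq0 := nz_row_sub (kermx coef_mx).
case/rV0Pn: nz => p vp; set v := nz_row _ in eq0 vp.
exists (fun i => v 0 (enum_rank i)); split; first by exists (enum_val p); rewrite enum_valK.
move=> j; have := eq0 0 (enum_rank j); rewrite !mxE => e; rewrite -[RHS]e.
rewrite [LHS]sum_enum_val.
by apply: eq_bigr => q _; rewrite !mxE enum_valK enum_rankK.
Qed.

Lemma dependent_card : (#|J| < #|I|)%N -> dependent.
Proof.
move=> lt; apply: dependent_not_row_free; rewrite /row_free neq_ltn.
by rewrite (leq_ltn_trans (rank_leq_col _) lt).
Qed.

(** With [independent_minor], this turns dependence into the vanishing of all maximal minors, which
    are polynomial in the entries. *)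
Lemma dependent_minor (f : 'I_#|I| -> J) :
  dependent -> \det (\matrix_(p, q) a (enum_val p) (f q)) = 0.
Proof.
case=> c [[i ci] ca]; apply/eqP/det0P; exists (\row_(p < #|I|) c (enum_val p)).
  by apply/rV0Pn; exists (enum_rank i); rewrite mxE enum_rankK.
apply/rowP => q; rewrite !mxE -[RHS](ca (f q)).
rewrite [RHS]sum_enum_val.
by apply: eq_bigr => p _; rewrite !mxE.
Qed.

Lemma independent_minor : ~ dependent ->
  exists f : 'I_#|I| -> J, \det (\matrix_(p, q) a (enum_val p) (f q)) != 0.
Proof.
move=> ndep; have fr : row_free coef_mx by apply/negP => /negP/dependent_not_row_free.
have ft : row_full coef_mx^T by rewrite /row_full mxrank_tr.
exists (fun q => enum_val (fullrankfun ft q)).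
have := fullrowsub_unit ft; rewrite unitmxE unitfE -det_tr.
by congr (\det _ != 0); apply/matrixP => p q; rewrite !mxE.
Qed.

End LinearDependence.

Section PolynomialFunctions.
Variables (K : fieldType) (k : nat).
Implicit Types f g : 'rV[K]_k -> K.

Definition poly_fun f : Prop :=
  exists F : {mpoly K[k]}, forall v : 'rV[K]_k, F.@[fun i => v 0 i] = f v.

Lemma poly_fun_ext f g : f =1 g -> poly_fun f -> poly_fun g.
Proof. by move=> fg [F hF]; exists F => v; rewrite hF fg. Qed.

Lemma poly_fun_const c : poly_fun (fun=> c).
Proof. by exists c%:MP => v; rewrite mevalC. Qed.

Lemma poly_fun_coord i : poly_fun (fun v : 'rV[K]_k => v 0 i).
Proof. by exists 'X_i => v; rewrite mevalXU. Qed.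

Lemma poly_funD f g : poly_fun f -> poly_fun g -> poly_fun (fun v => f v + g v).
Proof. by move=> [F hF] [G hG]; exists (F + G) => v; rewrite mevalD hF hG. Qed.

Lemma poly_funM f g : poly_fun f -> poly_fun g -> poly_fun (fun v => f v * g v).
Proof. by move=> [F hF] [G hG]; exists (F * G) => v; rewrite mevalM hF hG. Qed.

Lemma poly_fun_sum (I : Type) (r : seq I) (P : pred I) (f : I -> 'rV[K]_k -> K) :
  (forall i, poly_fun (f i)) -> poly_fun (fun v => \sum_(i <- r | P i) f i v).
Proof.
move=> hf; elim: r => [|i r IHr].
  by apply: poly_fun_ext (poly_fun_const 0) => v; rewrite big_nil.
case Pi: (P i); last by apply: poly_fun_ext IHr => v; rewrite big_cons Pi.
by apply: poly_fun_ext (poly_funD (hf i) IHr) => v; rewrite big_cons Pi.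
Qed.

Lemma poly_fun_prod (I : Type) (r : seq I) (f : I -> 'rV[K]_k -> K) :
  (forall i, poly_fun (f i)) -> poly_fun (fun v => \prod_(i <- r) f i v).
Proof.
move=> hf; elim: r => [|i r IHr].
  by apply: poly_fun_ext (poly_fun_const 1) => v; rewrite big_nil.
by apply: poly_fun_ext (poly_funM (hf i) IHr) => v; rewrite big_cons.
Qed.

Lemma poly_fun_det r (A : 'rV[K]_k -> 'M[K]_r) :
  (forall i j, poly_fun (fun v => A v i j)) -> poly_fun (fun v => \det (A v)).
Proof.
move=> hA; apply: poly_fun_sum => s; apply: poly_funM; first exact: poly_fun_const.
by apply: poly_fun_prod.
Qed.

End PolynomialFunctions.

Section PolynomialFamilies.
Variables (K : fieldType) (k N : nat).
Implicit Types h : 'rV[K]_k -> {mpoly K[N]}.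

Definition poly_fam h : Prop := forall m, poly_fun (fun q => (h q)@_m).

Lemma poly_fam_ext h1 h2 : h1 =1 h2 -> poly_fam h1 -> poly_fam h2.
Proof. by move=> e h m; apply: poly_fun_ext (h m) => v; rewrite e. Qed.

Lemma poly_fam_const p : poly_fam (fun=> p).
Proof. by move=> m; apply: poly_fun_const. Qed.

Lemma poly_famD h1 h2 :
  poly_fam h1 -> poly_fam h2 -> poly_fam (fun q => h1 q + h2 q).
Proof.
move=> p1 p2 m; apply: poly_fun_ext (poly_funD (p1 m) (p2 m)) => v.
by rewrite mcoeffD.
Qed.

Lemma poly_famM h1 h2 :
  poly_fam h1 -> poly_fam h2 -> poly_fam (fun q => h1 q * h2 q).
Proof.
move=> p1 p2 m.
apply: poly_fun_ext (_ : poly_fun (fun v =>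
  \sum_(i : 'X_{1..N < (mdeg m).+1, (mdeg m).+1} | m == (i.1 + i.2)%MM)
    (h1 v)@_i.1 * (h2 v)@_i.2)) => [v|]; first by rewrite mcoeffM.
by apply: poly_fun_sum => i; apply: poly_funM.
Qed.

Lemma poly_famZ f h :
  poly_fun f -> poly_fam h -> poly_fam (fun q => f q *: h q).
Proof.
move=> pf ph m; apply: poly_fun_ext (poly_funM pf (ph m)) => v.
by rewrite mcoeffZ.
Qed.

Lemma poly_fam_sum (I : Type) (r : seq I) (h : I -> 'rV[K]_k -> {mpoly K[N]}) :
  (forall i, poly_fam (h i)) -> poly_fam (fun q => \sum_(i <- r) h i q).
Proof.
move=> hh; elim: r => [|i r IHr].
  by apply: poly_fam_ext (poly_fam_const 0) => v; rewrite big_nil.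
by apply: poly_fam_ext (poly_famD (hh i) IHr) => v; rewrite big_cons.
Qed.

Lemma poly_fam_prod (I : Type) (r : seq I) (h : I -> 'rV[K]_k -> {mpoly K[N]}) :
  (forall i, poly_fam (h i)) -> poly_fam (fun q => \prod_(i <- r) h i q).
Proof.
move=> hh; elim: r => [|i r IHr].
  by apply: poly_fam_ext (poly_fam_const 1) => v; rewrite big_nil.
by apply: poly_fam_ext (poly_famM (hh i) IHr) => v; rewrite big_cons.
Qed.

Lemma poly_famX h e : poly_fam h -> poly_fam (fun q => h q ^+ e).
Proof.
move=> ph; apply: poly_fam_ext (poly_fam_prod (index_iota 0 e) (fun=> ph)) => v.
by rewrite prodr_const_nat subn0.
Qed.

Lemma poly_fam_deriv h i : poly_fam h -> poly_fam (fun q => (h q)^`M(i)).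
Proof.
move=> ph m; have := poly_funM (poly_fun_const k (m i).+1%:R) (ph (m + U_(i))%MM).
by apply: poly_fun_ext => v; rewrite mcoeff_deriv mulr_natl.
Qed.

Lemma poly_fam_comp a (b : {mpoly K[a]}) (t : 'I_a -> 'rV[K]_k -> {mpoly K[N]}) :
  (forall i, poly_fam (t i)) ->
  poly_fam (fun q => b \mPo [tuple t i q | i < a]).
Proof.
move=> ht; apply: poly_fam_ext (_ : poly_fam (fun q =>
  \sum_(m <- msupp b) b@_m *: \prod_i t i q ^+ m i)) => [q|].
  rewrite comp_mpolyEX; apply: eq_bigr => m _; rewrite comp_mpolyX.
  by congr (_ *: _); apply: eq_bigr => i _; rewrite tnth_mktuple.
apply: poly_fam_sum => m; apply: poly_famZ; first exact: poly_fun_const.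
by apply: poly_fam_prod => i; apply: poly_famX.
Qed.

End PolynomialFamilies.

Lemma poly_nonzero_eval (K : numDomainType) (p : {poly K}) :
  (forall t, t != 0 -> p.[t] = 0) -> p = 0.
Proof.
move=> hp; apply/eqP; apply: contraT => p0.
(* The integers from 1 to [size p] are nonzero and distinct in characteristic zero: one root too
   many for a nonzero [p]. *)
have := @max_poly_roots _ p [seq j.+1%:R | j <- iota 0 (size p)] p0.
rewrite size_map size_iota ltnn => -> //.
  by apply/allP => _ /mapP[j _ ->]; rewrite rootE hp // pnatr_eq0.
rewrite map_inj_uniq ?iota_uniq // => i j /eqP.
by rewrite eqr_nat eqSS => /eqP.
Qed.

(** * Conditions that pass to the projective Zariski closure *)

Section Closure.
Variables (R : realType) (k : nat).
Local Notation C := R[i].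

Lemma eval_at_scale d (F : {mpoly C[k]}) c v :
  F \is d.-homog -> eval_at F (c *: v) = c ^+ d * eval_at F v.
Proof.
move=> hF; rewrite /eval_at -(meval_dhomog _ _ hF).
by apply: meval_eq => i; rewrite mxE.
Qed.

(* Stability of [S] under scaling makes every homogeneous component of [F]
   vanish on [S]. *)
Lemma pclosure_vanish (S : set 'rV[C]_k) (F : {mpoly C[k]}) v :
  (forall w t, S w -> t != 0 -> S (t *: w)) ->
  (forall w, S w -> eval_at F w = 0) -> pclosure S v -> eval_at F v = 0.
Proof.
move=> scS FS [_ vS]; rewrite (pihomog_partitionE (mf := mdeg) (leqnn (msize F))).
rewrite /eval_at raddf_sum big1 //= => d _; apply: (vS d) => [|w Sw].
  exact: pihomogP.
pose p : {poly C} := \poly_(e < msize F) eval_at (pihomog mdeg e F) w.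
suff /polyP/(_ d) : p = 0 by rewrite coef_poly ltn_ord coef0.
apply: poly_nonzero_eval => t t0; rewrite horner_poly -[RHS](FS _ (scS _ _ Sw t0)).
rewrite [X in eval_at X (t *: w)](pihomog_partitionE (mf := mdeg) (leqnn (msize F))).
rewrite /eval_at raddf_sum /=; apply: eq_bigr => e _; rewrite mulrC.
by rewrite -/(eval_at _ _) -/(eval_at _ _) (eval_at_scale _ _ (pihomogP _ _ _)).
Qed.

Definition mpoly_dependent N (I : finType) (h : I -> {mpoly C[N]}) : Prop :=
  exists c : I -> C, (exists i, c i != 0) /\ \sum_i c i *: h i = 0.

(** Dependence is the vanishing of minors of the coefficient matrix, which are polynomial in the
    parameter. These minors need not be homogeneous, hence the scaling stability of [S]. *)
Lemma mpoly_dependent_closed N (I : finType) (S : set 'rV[C]_k)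
    (h : I -> 'rV[C]_k -> {mpoly C[N]}) v :
  (forall w t, S w -> t != 0 -> S (t *: w)) ->
  (forall i, poly_fam (h i)) ->
  (forall w, S w -> mpoly_dependent (h^~ w)) ->
  pclosure S v -> mpoly_dependent (h^~ v).
Proof.
move=> scS ph depS vS.
(* [B] bounds the degrees at [v] only. At a point of [S] higher coefficients are dropped, and the
   relation still holds for those that remain. *)
pose B := (\max_i msize (h i v))%N.
pose a w i (m : 'X_{1..N < B}) := (h i w)@_m.
have [[c [c0 ca]]|/independent_minor[f det0]] := pselect (dependent (a v)).
  exists c; split=> //; apply/mpolyP => m; rewrite mcoeff0 raddf_sum /=.
  have [mB|mB] := ltnP (mdeg m) B.
    by rewrite -[RHS](ca (BMultinom mB)); apply: eq_bigr => i _; rewrite mcoeffZ.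
  apply: big1 => i _; rewrite mcoeffZ; have := leq_bigmax (F := fun i => msize (h i v)) i.
  by move=> /leq_trans/(_ mB)/msize_mdeg_ge/memN_msupp_eq0 ->; rewrite mulr0.
have [F hF] : poly_fun (fun w => \det (\matrix_(p, q) a w (enum_val p) (f q))).
  apply: poly_fun_det => p q.
  by apply: poly_fun_ext (ph (enum_val p) (f q)) => w; rewrite mxE.
case/eqP: det0; rewrite -hF; apply: (pclosure_vanish scS) vS => w Sw.
rewrite /eval_at hF; apply: dependent_minor; have [c [c0 cw]] := depS w Sw.
exists c; split=> // m; have e := congr1 (mcoeff m) cw; rewrite mcoeff0 in e; rewrite -[RHS]e.
by rewrite raddf_sum; apply: eq_bigr => i _; rewrite /= mcoeffZ.
Qed.

End Closure.

(** * Chains of irreducible closed sets *)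

Section Chains.
Variables (R : realType) (M : nat).
Local Notation C := R[i].
Implicit Types (Z X : set 'rV[C]_M) (F G : {mpoly C[M]}).

Lemma pclosed_zeros Z F d : pclosed Z -> F \is d.-homog ->
  pclosed [set w | Z w /\ eval_at F w = 0].
Proof.
move=> clZ hF; apply/seteqP; split=> w /=.
  case=> w0 wZ; split; last by apply: (wZ d) => // u [].
  by rewrite -clZ; split=> // e G hG GZ; apply: (wZ e) => // u [Zu _]; apply: GZ.
case=> Zw Fw; have [w0 _] : pclosure Z w by rewrite clZ.
by split=> // e G _; apply.
Qed.

(** Otherwise the zero loci of [F] and [G] on [Z] would be two closed sets covering [Z], and one of
    them would be all of [Z]. *)
Lemma pirreducible_nonzero Z F G d e : pclosed Z -> pirreducible Z ->
  F \is d.-homog -> G \is e.-homog ->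
  (exists2 w, Z w & eval_at F w != 0) -> (exists2 w, Z w & eval_at G w != 0) ->
  exists2 w, Z w & eval_at F w != 0 /\ eval_at G w != 0.
Proof.
move=> clZ [_ irrZ] hF hG [u Zu Fu] [v Zv Gv].
have [//|no] := pselect (exists2 w, Z w & eval_at F w != 0 /\ eval_at G w != 0).
case: (irrZ _ _ (pclosed_zeros clZ hF) (pclosed_zeros clZ hG)) => [w Zw|s|s].
- have [Fw|Fw] := eqVneq (eval_at F w) 0; first by left.
  have [Gw|Gw] := eqVneq (eval_at G w) 0; first by right.
  by case: no; exists w.
- by case: (s u Zu) Fu => _ ->; rewrite eqxx.
- by case: (s v Zv) Gv => _ ->; rewrite eqxx.
Qed.

(* Divide by the largest power of [b j.+1] occurring in every term, then
   restrict to [Z j], where only the terms free of [b j.+1] survive. *)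
Lemma chain_independent (K : nat) (Z : nat -> set 'rV[C]_M)
    (b : nat -> {mpoly C[M]}) (e : nat)
    (T : finType) (c : T -> C) (al : T -> nat -> nat) :
  (forall i, (i <= K)%N -> pclosed (Z i) /\ pirreducible (Z i)) ->
  (forall i, (i < K)%N -> (Z i `<=` Z i.+1)%classic) ->
  (forall i, b i \is e.-homog) ->
  (forall i, (i <= K)%N -> exists2 w, Z i w & eval_at (b i) w != 0) ->
  (forall i w, (i < K)%N -> Z i w -> eval_at (b i.+1) w = 0) ->
  forall (j D : nat) (E : {set T}), (j <= K)%N ->
    (exists t, t \in E) -> (forall t, t \in E -> c t != 0) ->
    (forall t, t \in E -> (\sum_(i < j.+1) al t i)%N = D) ->
    {in E &, forall t u, (forall i, (i <= j)%N -> al t i = al u i) -> t = u} ->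
  exists2 w, Z j w &
    \sum_(t in E) c t * \prod_(i < j.+1) eval_at (b i) w ^+ al t i != 0.
Proof.
move=> irrZ sZ hb b0 bZ; elim=> [|j IHj] D E jK [t0 t0E] c0 degE injE.
  have [w Zw bw] := b0 0%N jK; exists w => //.
  (* With a single form, the degree [D] determines the exponent, so [E] is the singleton of [t0]. *)
  rewrite (big_pred1 t0) => [|t /=].
    by rewrite big_ord1 mulf_neq0 ?c0 // expf_neq0.
  apply/idP/eqP => [tE|->//]; apply: injE => // i; rewrite leqn0 => /eqP ->.
  by have := degE t tE; have := degE t0 t0E; rewrite !big_ord1 => -> ->.
have [t1 t1E minE] :=
  @arg_minnP _ t0 (fun t => t \in E) (fun t => al t j.+1) t0E.
set p := al t1 j.+1 in minE.
pose E' := finset (fun t => (t \in E) && (al t j.+1 == p)).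
have sE' t : t \in E' -> t \in E by rewrite finset.in_set => /andP[].
have [] := IHj (D - p)%N E' (ltnW jK) _ _ _ _.
- by exists t1; rewrite finset.in_set t1E eqxx.
- by move=> t /sE'; apply: c0.
- move=> t tE'; rewrite -(degE t (sE' _ tE')) [in RHS]big_ord_recr /=.
  by move: tE'; rewrite finset.in_set => /andP[_ /eqP ->]; rewrite addnK.
- move=> t u tE uE eqtu; apply: injE; rewrite ?sE' // => i.
  rewrite leq_eqVlt => /predU1P[->|]; last exact: eqtu.
  by move: tE uE; rewrite !finset.in_set => /andP[_ /eqP ->] /andP[_ /eqP ->].
move=> w Zw sumw; pose H : {mpoly C[M]} := \sum_(t in E)
  c t *: (\prod_(i < j.+1) b i ^+ al t i * b j.+1 ^+ (al t j.+1 - p)).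
have eqH u : eval_at H u = \sum_(t in E) c t *
    (\prod_(i < j.+1) eval_at (b i) u ^+ al t i *
     eval_at (b j.+1) u ^+ (al t j.+1 - p)).
  rewrite /eval_at raddf_sum /=; apply: eq_bigr => t _.
  rewrite mevalZ mevalM rmorph_prod rmorphXn; congr (_ * (_ * _)).
  by apply: eq_bigr => i _; rewrite rmorphXn.
have hH : H \is (e * (D - p))%N.-homog.
  apply: rpred_sum => t tE; apply: dhomogZ.
  have -> : (e * (D - p) =
      \sum_(i < j.+1) e * al t i + e * (al t j.+1 - p))%N.
    rewrite -big_distrr -mulnDr /= addnBA ?minE //; congr (_ * (_ - _))%N.
    by rewrite -(degE t tE) [LHS]big_ord_recr.
  apply: dhomogM; last exact: dhomogMn.
  by apply: dhomog_bigprod => i; apply: dhomogMn.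
have [clZ iZ] := irrZ _ jK.
have Hw : eval_at H w != 0.
  rewrite eqH (bigID (fun t => al t j.+1 == p)) /= [X in _ + X]big1 ?addr0.
    rewrite (eq_bigl (fun t => t \in E')) => [|t]; last by rewrite finset.in_set.
    congr (_ != 0): sumw; apply: eq_bigr => t; rewrite finset.in_set => /andP[_ /eqP ->].
    by rewrite subnn expr0 mulr1.
  move=> t /andP[tE tp]; rewrite bZ // expr0n subn_eq0 leqNgt ltn_neqAle minE //.
  by rewrite eq_sym tp !mulr0.
(* [H] and [b j.+1] are each nonzero somewhere on the irreducible [Z j.+1], hence at a common point;
   multiplying back by the power [p] there keeps the sum nonzero. *)
have [||u Zu [Hu bu]] := pirreducible_nonzero clZ iZ hH (hb j.+1).
- by exists w => //; apply: (sZ j jK).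
- exact: b0.
exists u => //; have := mulf_neq0 Hu (expf_neq0 p bu); rewrite eqH mulr_suml.
congr (_ != 0); apply: eq_bigr => t tE; rewrite [in RHS]big_ord_recr /=.
by rewrite -!mulrA -exprD subnK // minE.
Qed.

(** Strictness of the chain gives forms that vanish on one member but not on the next. Suitable
    powers share a degree [e], and by [chain_independent] no nontrivial homogeneous relation between
    them holds on [X]. *)
Lemma chain_forms X (d K : nat) : irreducible_chain X d -> (K <= d)%N ->
  exists (e : nat) (b : nat -> {mpoly C[M]}), (forall i, b i \is e.-homog) /\
  forall (T : finType) (c : T -> C) (al : T -> nat -> nat) D,
    (forall t, (\sum_(i < K.+1) al t i)%N = D) ->
    (forall t u, (forall i, (i <= K)%N -> al t i = al u i) -> t = u) ->
    (exists t, c t != 0) ->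
  exists2 w, X w & \sum_t c t * \prod_(i < K.+1) eval_at (b i) w ^+ al t i != 0.
Proof.
move=> [Z [hZ sZ]] Kd.
(* The guard [i <= K] lets a form be chosen for every natural number. Positive degrees make the
   exponents [e %/ (dF i).1] below positive, so the powers vanish where the forms do. *)
pose good i (dF : nat * {mpoly C[M]}) :=
  [/\ (0 < dF.1)%N, dF.2 \is dF.1.-homog &
      (i <= K)%N -> (exists2 w, Z i w & eval_at dF.2 w != 0) /\
      forall w, (0 < i)%N -> Z i.-1 w -> eval_at dF.2 w = 0].
have coordn0 (w : 'rV[C]_M) : w != 0 -> exists j, eval_at 'X_j w != 0.
  by move=> /rV0Pn[j wj]; exists j; rewrite /eval_at mevalXU.
have Z0 i w : (i <= d)%N -> Z i w -> w != 0.
  by move=> /hZ[clZ _ _]; rewrite -{1}clZ => -[].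
have /choice[dF hdF] : forall i, exists dF, good i dF.
  move=> i; have [iK|iK] := leqP i K; last first.
    exists (1%N, 0); split; rewrite ?dhomog0 // => iK'.
    by rewrite leqNgt iK in iK'.
  case: i iK => [|i] iK.
    have [_ [[w Zw] _] _] := hZ 0%N isT; have [j wj] := coordn0 w (Z0 0%N w isT Zw).
    by exists (1%N, 'X_j); split=> //=; [apply: dhomog_Xi|split=> //; exists w].
  have id : (i < d)%N := leq_trans iK Kd.
  have [_ /existsNP[w /not_implyP[Zw nZw]]] := sZ i id.
  have w0 := Z0 _ _ id Zw; have [clZ _ _] := hZ i (ltnW id).
  have [[e [F [hF FZ Fw]]]|no] := pselect (exists e F, [/\ F \is e.-homog,
      (forall u, Z i u -> eval_at F u = 0) & eval_at F w != 0]).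
    have [j wj] := coordn0 w w0.
    (* The factor ['X_j], nonzero at [w], makes the degree positive. *)
    exists (e.+1, F * 'X_j); split=> //=.
      by rewrite -addn1; apply: dhomogM => //; apply: dhomog_Xi.
    move=> _; split.
      by exists w => //; rewrite /eval_at mevalM; apply: mulf_neq0.
    by move=> u _ Zu; rewrite /eval_at mevalM -/(eval_at F u) FZ // mul0r.
  (* If no such form existed, [w] would lie in the closure of [Z i], which is [Z i] itself. *)
  case: nZw; rewrite -clZ; split=> // e F hF FZ; apply/eqP/negPn/negP => Fw.
  by case: no; exists e, F.
pose e := (\prod_(i < K.+1) (dF i).1)%N.
pose b i := if (i <= K)%N then (dF i).2 ^+ (e %/ (dF i).1) else 0.
have hb i : b i \is e.-homog.
  rewrite /b; case: leqP => iK; last exact: dhomog0.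
  have dvd : ((dF i).1 %| e)%N.
    by rewrite /e (bigD1 (Ordinal (iK : (i < K.+1)%N))) //= dvdn_mulr.
  by rewrite -{2}(divnK dvd) mulnC; apply: dhomogMn; case: (hdF i).
have evb i w : (i <= K)%N ->
    eval_at (b i) w = eval_at (dF i).2 w ^+ (e %/ (dF i).1).
  by move=> iK; rewrite /b iK /eval_at rmorphXn.
exists e, b; split=> // T c al D degT injT [t0 ct0].
have [||||||||w Zw sumw] := @chain_independent K Z b e T c al _ _ hb _ _ K D
    (finset (fun t => c t != 0)) (leqnn K).
- by move=> i iK; have [? ? _] := hZ i (leq_trans iK Kd).
- by move=> i iK; have [] := sZ i (leq_trans iK Kd).
- move=> i iK; have [_ _ /(_ iK)[[w Zw Fw] _]] := hdF i; exists w => //.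
  by rewrite evb // expf_neq0.
- move=> i w iK Zw; have [d0 _ /(_ iK)[_ Fw]] := hdF i.+1.
  rewrite evb // Fw // expr0n -leqn0 leqNgt divn_gt0 //.
  rewrite /e (bigD1 (Ordinal (iK : (i.+1 < K.+1)%N))) //= leq_pmulr //.
  by rewrite prodn_gt0 // => l; case: (hdF l).
- by exists t0; rewrite finset.in_set.
- by move=> t; rewrite finset.in_set.
- by move=> t _; apply: degT.
- by move=> t u _ _; apply: injT.
exists w; first by have [_ _] := hZ K Kd; apply.
congr (_ != 0): sumw; rewrite [RHS](bigID (fun t => c t != 0)) /=.
rewrite [X in _ = _ + X]big1 ?addr0 => [|t /negPn/eqP ->]; last by rewrite mul0r.
by apply: eq_bigl => t; rewrite finset.in_set.
Qed.

End Chains.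

(** * Relations between forms *)

Section Counting.
Variables (k T0 : nat).

(* The exponents of a monomial of degree [k * T0] in [k.+1] variables; the
   exponents of the first [k] variables range freely over [0, T0]. *)
Definition expo (t : {ffun 'I_k -> 'I_T0.+1}) (i : nat) : nat :=
  if insub i is Some j then t j : nat else (k * T0 - \sum_j t j)%N.

Lemma expo_ord t (j : 'I_k) : expo t j = t j.
Proof. by rewrite /expo valK. Qed.

Lemma sum_expo t : (\sum_(i < k.+1) expo t i = k * T0)%N.
Proof.
rewrite big_ord_recr /= [X in (_ + X)%N]/expo insubF ?ltnn //.
rewrite (eq_bigr (fun j => nat_of_ord (t j))) => [|j _]; last exact: expo_ord.
rewrite subnKC // -[X in (_ <= X * _)%N]card_ord -sum_nat_const.
by apply: leq_sum => j _; rewrite -ltnS.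
Qed.

Lemma expo_inj t u : (forall i, (i <= k)%N -> expo t i = expo u i) -> t = u.
Proof.
move=> e; apply/ffunP => j; apply: val_inj.
by rewrite /= -!expo_ord e // ltnW.
Qed.

End Counting.

(** Dimension count: there are more products than monomials of their common degree. [T0] depends
    only on [k] and [e], so the relations for all families [p] have the same shape, as a closure
    argument requires. *)
Lemma homog_relation (K : fieldType) (k e : nat) :
  exists T0 : nat, forall p : nat -> {mpoly K[k.+1]},
    (forall i, p i \is e.-homog) ->
  exists c : {ffun 'I_k.+1 -> 'I_T0.+1} -> K, (exists t, c t != 0) /\
    \sum_t c t *: \prod_(i < k.+2) p i ^+ expo t i = 0.
Proof.
(* This choice gives [(s + 1) ^ k <= T0 * (T0 + 1) ^ k < (T0 + 1) ^ (k + 1)], where [s] is the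
   degree of the products. *)
pose T0 := ((e * k.+1).+1 ^ k)%N; exists T0 => p hp.
pose s := (e * (k.+1 * T0))%N.
(* In degree [s] the last exponent is determined by the others. If these already exceed [s], the
   monomial has a larger degree and its coefficient is zero. *)
pose mon (u : {ffun 'I_k -> 'I_s.+1}) : 'X_{1..k.+1} :=
  [multinom (if unlift ord_max i is Some j then u j : nat
             else (s - \sum_j u j)%N) | i < k.+1].
pose a (t : {ffun 'I_k.+1 -> 'I_T0.+1}) u :=
  (\prod_(i < k.+2) p i ^+ expo t i)@_(mon u).
have [|c [c0 ca]] := @dependent_card _ _ _ a.
  rewrite !card_ffun !card_ord expnS.
  have le : (s.+1 <= (e * k.+1).+1 * T0.+1)%N.
    by rewrite /s mulnA; move: (e * k.+1)%N (T0) => x z; nia.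
  apply: (@leq_ltn_trans (T0 * T0.+1 ^ k)).
    have mono x z : (x <= z -> x ^ k <= z ^ k)%N by case: (k) => // l; rewrite leq_exp2r.
    by rewrite /T0 -expnMn mono.
  by rewrite ltn_pmul2r ?expn_gt0.
exists c; split=> //; apply/mpolyP => m; rewrite mcoeff0.
have hF : \sum_t c t *: \prod_(i < k.+2) p i ^+ expo t i \is s.-homog.
  apply: rpred_sum => t _; apply: dhomogZ.
  rewrite /s -(sum_expo t) big_distrr.
  by apply: dhomog_bigprod => i; apply: dhomogMn.
have [ms|/(dhomog_coeff0 hF)//] := eqVneq (mdeg m) s.
have le_m i : (m i < s.+1)%N by rewrite ltnS -ms mdegE (bigD1 i) //= leq_addr.
suff -> : m = mon [ffun j => Ordinal (le_m (lift ord_max j))].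
  rewrite -[RHS](ca [ffun j => Ordinal (le_m (lift ord_max j))]) raddf_sum.
  by apply: eq_bigr => t _; rewrite /= mcoeffZ.
apply/mnmP => i; rewrite mnmE; case: unliftP => [j|] ->; first by rewrite ffunE.
rewrite (eq_bigr (fun j => m (lift ord_max j))) => [|j _]; last by rewrite ffunE.
apply/esym/eqP; rewrite -(eqn_add2r (\sum_j m (lift ord_max j))).
have sm : (m ord_max + \sum_j m (lift ord_max j))%N = s.
  by rewrite -ms mdegE [RHS](bigD1_ord ord_max).
by rewrite subnK; [apply/eqP/esym/sm|rewrite -[X in (_ <= X)%N]sm leq_addl].
Qed.

(** * Monomials modulo two by two minors *)

Section Straightening.
Variables (A : comNzRingType) (f : A) (n : nat) (y : 'I_n -> 'I_n -> A).
Hypothesis y_minor : forall i j k l,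
  exists u, y i j * y k l - y i l * y k j = u * f.

(** A minor relation exchanges the column indices of two factors modulo [f], so only the multisets
    of row and of column indices matter. *)
Lemma straighten (L L' : seq ('I_n * 'I_n)) :
  perm_eq (unzip1 L) (unzip1 L') -> perm_eq (unzip2 L) (unzip2 L') ->
  exists u, \prod_(x <- L) y x.1 x.2 - \prod_(x <- L') y x.1 x.2 = u * f.
Proof.
elim: L L' => [|[i j] L1 IHL] L' /= p1 p2.
  have -> : L' = [::].
    by apply/nilP; have := perm_size p1; rewrite /= size_map /nilp => <-.
  by exists 0; rewrite mul0r subrr.
have /mapP[[i' j'] x'L' /= eq_i] : i \in unzip1 L'.
  by rewrite -(perm_mem p1) mem_head.
rewrite -{i'}eq_i in x'L'; have pL' := perm_to_rem x'L'.
have {}p1 : perm_eq (unzip1 L1) (unzip1 (rem (i, j') L')).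
  by rewrite -(perm_cons i) (permPl p1); apply: perm_map pL'.
have {}p2 : perm_eq (j :: unzip2 L1) (j' :: unzip2 (rem (i, j') L')).
  by rewrite (permPl p2); apply: perm_map pL'.
rewrite (perm_big _ pL') !big_cons /=; move: (rem _ _) p1 p2 => L2 p1 p2.
have [jj|jj] := eqVneq j j'.
  rewrite -jj perm_cons in p2 *; have [u eu] := IHL _ p1 p2.
  by exists (y i j * u); rewrite -mulrBr eu mulrA.
(* Column [j] occurs in another factor [(i', j)]. One exchange replaces [y i j' * y i' j] by
   [y i j * y i' j'], and [y i j] splits off. *)
have /mapP[[i' j2] x'L2 /= eq_j] : j \in unzip2 L2.
  by have := mem_head j (unzip2 L1); rewrite (perm_mem p2) inE (negPf jj).
rewrite -{j2}eq_j in x'L2; have pL2 := perm_to_rem x'L2.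
have {}p1 : perm_eq (unzip1 L1) (unzip1 ((i', j') :: rem (i', j) L2)).
  by rewrite (permPl p1); apply: perm_map pL2.
have {}p2 : perm_eq (unzip2 L1) (unzip2 ((i', j') :: rem (i', j) L2)).
  rewrite -(perm_cons j) (permPl p2).
  apply: (@perm_trans _ (j' :: j :: unzip2 (rem (i', j) L2))).
    by rewrite perm_cons; apply: perm_map pL2.
  exact/permPl/(perm_catCA [:: j'] [:: j]).
rewrite (perm_big _ pL2) !big_cons /=; have [u eu] := IHL _ p1 p2.
have [v ev] := y_minor i j i' j'; rewrite big_cons /= in eu.
move: eu ev; set P := \prod_(x <- L1) _; set Q := \prod_(x <- _) _ => eu ev.
exists (y i j * u + v * Q); rewrite mulrDl -mulrA -eu mulrAC -ev; ring.
Qed.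

End Straightening.

Lemma prod_seq_count (A : comNzRingType) N (L : seq 'I_N) (F : 'I_N -> A) :
  \prod_(j <- L) F j = \prod_j F j ^+ count_mem j L.
Proof.
elim: L => [|x L IHL]; first by rewrite big_nil big1.
rewrite big_cons IHL [in RHS](bigD1 x) //= eqxx add1n exprS -mulrA.
rewrite [in LHS](bigD1 x) //=; congr (_ * (_ * _)).
by apply: eq_bigr => j jx; rewrite eq_sym (negPf jx).
Qed.

Lemma prod_m2s (A : comNzRingType) N (m : 'X_{1..N}) (F : 'I_N -> A) :
  \prod_j F j ^+ m j = \prod_(j <- m2s m) F j.
Proof.
by rewrite prod_seq_count -{1}(s2mK m); apply: eq_bigr => j _; rewrite mnmE.
Qed.

(* A polynomial vanishing on the rank one matrices [u v^T] is a combination of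
   differences of monomials with the same row and column indices. *)
Lemma rank_one_ideal (K : fieldType) N N' n (r s : 'I_N -> 'I_n)
    (f : {mpoly K[N']}) (y : 'I_n -> 'I_n -> {mpoly K[N']}) (F : {mpoly K[N]}) :
  (forall i j k l, exists u, y i j * y k l - y i l * y k j = u * f) ->
  F \mPo [tuple 'X_(lshift n (r j)) * 'X_(rshift n (s j)) | j < N] =
    0 :> {mpoly K[n + n]} ->
  exists u, F \mPo [tuple y (r j) (s j) | j < N] = u * f.
Proof.
move=> ymin F0.
(* The exponent of the pullback of ['X_[m]] to rank one matrices; it records the row and column
   indices with multiplicity. *)
pose cl (m : 'X_{1..N}) :=
  (\sum_(j <- m2s m) (U_(lshift n (r j)) + U_(rshift n (s j))))%MM.
pose Y (m : 'X_{1..N}) := \prod_(j <- m2s m) y (r j) (s j).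
pose rep c := head 0 [seq Y m | m <- msupp F & cl m == c].
have clP m : 'X_[m] \mPo [tuple 'X_(lshift n (r j)) * 'X_(rshift n (s j)) | j < N]
    = 'X_[cl m] :> {mpoly K[n + n]}.
  rewrite comp_mpolyX prod_m2s -mprodXE.
  by apply: eq_bigr => j _; rewrite tnth_mktuple mpolyXD.
have YP m : 'X_[m] \mPo [tuple y (r j) (s j) | j < N] = Y m.
  by rewrite comp_mpolyX prod_m2s; apply: eq_bigr => j _; rewrite tnth_mktuple.
have cl_l m i : cl m (lshift n i) = count_mem i (map r (m2s m)).
  rewrite mnm_sumE count_map -sum1_count [RHS]big_mkcond /=.
  by apply: eq_bigr => j _; rewrite mnmDE !mnm1E eq_lshift eq_rlshift addn0; case: eqP.
have cl_r m i : cl m (rshift n i) = count_mem i (map s (m2s m)).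
  rewrite mnm_sumE count_map -sum1_count [RHS]big_mkcond /=.
  by apply: eq_bigr => j _; rewrite mnmDE !mnm1E eq_rshift eq_lrshift add0n; case: eqP.
have repP m : m \in msupp F -> exists u, Y m - rep (cl m) = u * f.
  move=> mF; rewrite /rep.
  have : m \in [seq m' <- msupp F | cl m' == cl m] by rewrite mem_filter eqxx.
  case E: [seq _ <- _ | _] => [|m' L] //= _.
  have : m' \in [seq m' <- msupp F | cl m' == cl m] by rewrite E mem_head.
  rewrite mem_filter => /andP[/eqP eq_cl _].
  have [||u] := @straighten _ f n y ymin [seq (r j, s j) | j <- m2s m]
                                         [seq (r j, s j) | j <- m2s m'].
  - by rewrite /unzip1 -!map_comp; apply/allP => i _; rewrite /= -!cl_l eq_cl.
  - by rewrite /unzip2 -!map_comp; apply/allP => i _; rewrite /= -!cl_r eq_cl.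
  by rewrite !big_map /=; exists u.
(* Over each class of [cl], the coefficients of [F] add up to a coefficient of the pullback of [F]
   to rank one matrices, which is zero. *)
have rep0 : \sum_(m <- msupp F) F@_m *: rep (cl m) = 0.
  pose Cs := undup (map cl (msupp F)).
  transitivity (\sum_(c <- Cs) (F \mPo
    [tuple 'X_(lshift n (r j)) * 'X_(rshift n (s j)) | j < N])@_c *: rep c);
    last by rewrite big1 // => c _; rewrite F0 mcoeff0 scale0r.
  have coefF c : (F \mPo [tuple 'X_(lshift n (r j)) * 'X_(rshift n (s j)) | j < N])@_c
      = \sum_(m <- msupp F) F@_m * (cl m == c)%:R.
    rewrite comp_mpolyEX raddf_sum; apply: eq_bigr => m _.
    by rewrite /= clP mcoeffZ mcoeffX.
  under [RHS]eq_bigr => c _ do rewrite coefF scaler_suml.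
  rewrite exchange_big /= big_seq [RHS]big_seq; apply: eq_bigr => m mF.
  rewrite (bigD1_seq (cl m)) ?undup_uniq //=; last by rewrite mem_undup map_f.
  rewrite big1 => [|c cm]; last by rewrite eq_sym (negPf cm) mulr0 scale0r.
  by rewrite eqxx mulr1 addr0.
have -> : F \mPo [tuple y (r j) (s j) | j < N] =
    \sum_(m <- msupp F) F@_m *: (Y m - rep (cl m)).
  under [RHS]eq_bigr do rewrite scalerBr.
  rewrite sumrB rep0 subr0 comp_mpolyEX.
  by apply: eq_bigr => m _; rewrite YP.
rewrite big_seq; elim/big_rec: _ => [|m p /repP[u ->] [v ->]].
  by exists 0; rewrite mul0r.
by exists (F@_m *: u + v); rewrite mulrDl scalerAl.
Qed.

(** * The gradient of the determinant *)

Section AdjugateMinors.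
Variables (K : comNzRingType) (n : nat).
Implicit Types A : 'M[K]_n.

Definition set_row A (p : 'I_n) (v : 'I_n -> K) : 'M[K]_n :=
  \matrix_(a, b) if a == p then v b else A a b.

Lemma cofactor_set_row A p v b : cofactor (set_row A p v) p b = cofactor A p b.
Proof.
rewrite /cofactor; congr (_ * \det _); apply/matrixP => i j.
by rewrite !mxE eq_sym (negPf (neq_lift _ _)).
Qed.

Lemma det_set_row A p v : \det (set_row A p v) = \sum_b v b * cofactor A p b.
Proof.
rewrite (expand_det_row _ p); apply: eq_bigr => b _.
by rewrite cofactor_set_row mxE eqxx.
Qed.

Lemma det_set_row_delta A p l :
  \det (set_row A p (fun b => (b == l)%:R)) = cofactor A p l.
Proof.
rewrite det_set_row (bigD1 l) //= eqxx mul1r big1 ?addr0 // => b bl.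
by rewrite (negPf bl) mul0r.
Qed.

(* With [B] obtained from [A] by replacing row [k] by the [l]-th basis vector,
   column [i] of [A *m \adj B] has only two nonzero entries, and multiplying
   by [\adj A] gives the identity, with cofactor [u = cofactor B i j]. *)
Lemma cofactor_minor A i j k l : exists u,
  cofactor A i j * cofactor A k l - cofactor A i l * cofactor A k j = u * \det A.
Proof.
have [->|ik] := eqVneq i k; first by exists 0; rewrite mul0r mulrC subrr.
pose dl (b : 'I_n) : K := (b == l)%:R.
pose B := set_row A k dl; exists (cofactor B i j).
have detB : \det B = cofactor A k l := det_set_row_delta A k l.
(* [w p] is the entry [(p, i)] of [A *m \adj B]. *)
pose w p := \sum_b A p b * cofactor B i b.
have w_k : w k = - cofactor A i l.
  rewrite /w -(det_set_row B i (A k)) -det_set_row_delta.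
  (* Row [k] of [A] now sits in row [i] and the basis vector in row [k]; exchanging them costs a
     sign. *)
  have -> : set_row B i (A k) = xrow i k (set_row A i dl).
    apply/matrixP => a b; rewrite !mxE.
    case: tpermP => [->|->|/eqP ai /eqP ak].
    - by rewrite eqxx eq_sym (negPf ik).
    - by rewrite eqxx eq_sym (negPf ik) eqxx.
    - by rewrite (negPf ai) (negPf ak).
  by rewrite xrowE det_mulmx det_perm odd_tperm ik expr1 mulN1r.
have w_p p : p != k -> w p = (p == i)%:R * cofactor A k l.
  move=> pk; have /matrixP/(_ p i) := mul_mx_adj B.
  rewrite !mxE detB mulr_natl => <-; apply: eq_bigr => b _.
  by rewrite !mxE (negPf pk).
(* The entry [(j, i)] of [\adj A *m A *m \adj B], computed in two ways. *)
have -> : cofactor B i j * \det A = \sum_p cofactor A p j * w p.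
  transitivity (\sum_b (\adj A *m A) j b * cofactor B i b).
    rewrite mul_adj_mx (bigD1 j) //= mxE eqxx mulr1n big1 ?addr0 1?mulrC // => b bj.
    by rewrite mxE eq_sym (negPf bj) mulr0n mul0r.
  under eq_bigr do rewrite mxE mulr_suml.
  rewrite exchange_big; apply: eq_bigr => p _; rewrite mulr_sumr.
  by apply: eq_bigr => b _; rewrite mxE -mulrA.
rewrite (bigD1 i) //= (bigD1 k) 1?eq_sym //= w_k w_p // eqxx mul1r.
rewrite big1 ?addr0 => [|p /andP[pi pk]]; first by ring.
by rewrite w_p // (negPf pi) mul0r mulr0.
Qed.

End AdjugateMinors.

Lemma mderiv_det_eq0 (K : comNzRingType) N r (A : 'M[{mpoly K[N]}]_r) a :
  (forall i j, (A i j)^`M(a) = 0) -> (\det A)^`M(a) = 0.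
Proof.
move=> dA; rewrite /determinant raddf_sum big1 // => s _ /=.
rewrite mulr_sign; case: ifP => _; rewrite ?mderivN.
all: rewrite (_ : mderiv _ _ = 0) ?oppr0 //.
all: elim/big_rec: _ => [|i p _ IH]; first by rewrite -mpolyC1 mderivC.
all: by rewrite mderivM dA IH mul0r mulr0 addr0.
Qed.

Section DetForm.
Variables (R : realType) (n : nat).
Local Notation C := R[i].

Definition generic_mx : 'M[{mpoly C[n * n]}]_n :=
  \matrix_(i, j) 'X_(mxvec_index i j).

Definition mxvec_row (j : 'I_(n * n)) : 'I_n :=
  (enum_val (cast_ord (esym (mxvec_cast n n)) j)).1.

Definition mxvec_col (j : 'I_(n * n)) : 'I_n :=
  (enum_val (cast_ord (esym (mxvec_cast n n)) j)).2.

Lemma mxvec_rowK j : mxvec_index (mxvec_row j) (mxvec_col j) = j.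
Proof. by rewrite /mxvec_index -surjective_pairing enum_valK cast_ordKV. Qed.

Lemma mxvec_index_inj i j k l :
  (mxvec_index i j == mxvec_index k l :> 'I_(n * n)) = (i == k) && (j == l).
Proof.
by rewrite (inj_eq (@cast_ord_inj _ _ _)) (inj_eq enum_rank_inj) xpair_eqE.
Qed.

Lemma det_form_homog : det_form R n \is n.-homog.
Proof.
apply: rpred_sum => s _; rewrite rpredMsign.
have := @dhomog_bigprod C _ _ (index_enum 'I_n)
  (fun i => generic_mx i (s i)) (fun=> 1%N).
rewrite sum1_card card_ord; apply=> i.
by rewrite mxE; apply: dhomog_Xi.
Qed.

(** Laplace expansion along the row of the variable, since the cofactors of that row do not contain
    it. *)
Lemma mderiv_det_form j :
  (det_form R n)^`M(j) = cofactor generic_mx (mxvec_row j) (mxvec_col j).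
Proof.
rewrite -{1}(mxvec_rowK j); set i := mxvec_row j; set l := mxvec_col j.
rewrite /det_form -/generic_mx (expand_det_row _ i) raddf_sum /=.
have dcof b : (cofactor generic_mx i b)^`M(mxvec_index i l) = 0.
  have d0 : (\det (row' i (col' b generic_mx)))^`M(mxvec_index i l) = 0.
    apply: mderiv_det_eq0 => p q.
    by rewrite !mxE mderiv_Xi mxvec_index_inj eq_sym (negPf (neq_lift _ _)).
  by rewrite /cofactor -signr_odd mulr_sign; case: ifP => _; rewrite ?mderivN d0 ?oppr0.
rewrite (bigD1 l) //= big1 => [|b bl]; rewrite mderivM dcof mulr0 addr0.
  by rewrite mxE mderiv_Xi eqxx mul1r addr0.
by rewrite mxE mderiv_Xi mxvec_index_inj (negPf bl) andbF mul0r.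
Qed.

End DetForm.

(** * Linear substitutions and the chain rule *)

Section LinearSubstitution.
Variables (R : realType).
Local Notation C := R[i].

Definition grad_tuple N (Q : {mpoly C[N]}) := [tuple Q^`M(j) | j < N].

Lemma dhomog_lin_form N (a : 'rV[C]_N) : lin_form a \is 1.-homog.
Proof. by apply: rpred_sum => j _; apply/dhomogZ/dhomog_Xi. Qed.

Lemma mderiv_lin_form N (a : 'rV[C]_N) j : (lin_form a)^`M(j) = (a 0 j)%:MP.
Proof.
rewrite /lin_form raddf_sum (bigD1 j) //= big1 ?addr0 => [|i ij].
  by rewrite mderivZ mderiv_Xi eqxx -mul_mpolyC mulr1.
by rewrite mderivZ mderiv_Xi (negPf ij) scaler0.
Qed.

Lemma dhomog_lin_subst M N (A : 'M[C]_(M, N)) P d :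
  P \is d.-homog -> lin_subst A P \is d.-homog.
Proof.
move=> hP; rewrite -[d]muln1; apply: dhomog_comp => // i.
by rewrite tnth_mktuple; apply: dhomog_lin_form.
Qed.

Lemma eval_lin_form N (a v : 'rV[C]_N) : eval_at (lin_form a) v = (v *m a^T) 0 0.
Proof.
rewrite /eval_at raddf_sum mxE; apply: eq_bigr => j _ /=.
by rewrite mevalZ mevalXU mxE mulrC.
Qed.

Lemma eval_lin_subst M N (A : 'M[C]_(M, N)) P v :
  eval_at (lin_subst A P) v = eval_at P (v *m A^T).
Proof.
rewrite /eval_at comp_mpoly_meval; apply: meval_eq => i.
rewrite tnth_mktuple -/(eval_at _ _) eval_lin_form !mxE.
by apply: eq_bigr => j _; rewrite !mxE.
Qed.

Lemma mderiv_lin_subst M N (A : 'M[C]_(M, N)) P j :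
  (lin_subst A P)^`M(j) = \sum_i A i j *: lin_subst A P^`M(i).
Proof.
rewrite mderiv_comp; apply: eq_bigr => i _.
by rewrite tnth_mktuple mderiv_lin_form mxE mulrC mul_mpolyC.
Qed.

(** By the chain rule the gradient of the pullback is the transpose of [g] applied to the pulled
    back gradient; the transpose is moved onto [b]. This reduces points of the orbit to the
    determinant itself. *)
Lemma comp_grad_lin_subst N (g : 'M[C]_N) (b Q : {mpoly C[N]}) :
  b \mPo grad_tuple (lin_subst g Q) =
  lin_subst g (lin_subst g^T b \mPo grad_tuple Q).
Proof.
have dQ j : (lin_subst g Q)^`M(j) = lin_subst g (lin_form (row j g^T) \mPo grad_tuple Q).
  rewrite mderiv_lin_subst /lin_form linear_sum /lin_subst linear_sum.
  apply: eq_bigr => i _ /=.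
  by rewrite !comp_mpolyZ comp_mpolyXi tnth_mktuple !mxE.
rewrite [RHS](comp_mpolyA (lin_subst g^T b)) [RHS](comp_mpolyA b).
apply: (congr1 (fun t => b \mPo t)); apply: eq_from_tnth => j.
rewrite [LHS]tnth_mktuple [RHS]tnth_mktuple dQ [in RHS]tnth_mktuple.
by rewrite /lin_subst comp_mpolyA.
Qed.

End LinearSubstitution.

(* The polar map sends the hypersurface [det = 0] to the cone of rank one
   matrices, parametrized by the [2n] coordinates of two vectors. *)
Lemma det_orbit_relation (R : realType) n e : (0 < n)%N ->
  exists T0 : nat, forall (b : nat -> {mpoly R[i][n * n]}) (g : 'M[R[i]]_(n * n)),
    (forall i, b i \is e.-homog) ->
  exists (c : {ffun 'I_(n + n) -> 'I_T0.+1} -> R[i]) (u : {mpoly R[i][n * n]}),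
    (exists t, c t != 0) /\
    \sum_t c t *: \prod_(i < (n + n).+1)
      (b i \mPo grad_tuple (lin_subst g (det_form R n))) ^+ expo t i =
    u * lin_subst g (det_form R n).
Proof.
(* For the original [n] these are [2n + 1] forms in [2n] variables. Their degree is [e * 2] because
   the entries of [Phi] are quadratic. *)
case: n => // n _; have [T0 relT0] := homog_relation R[i] (n + n.+1) (e * 2).
exists T0 => b g hb.
pose B i := lin_subst g^T (b i).
pose Phi := [tuple 'X_(lshift n.+1 (mxvec_row j)) * 'X_(rshift n.+1 (mxvec_col j))
  | j < n.+1 * n.+1] : (n.+1 * n.+1).-tuple {mpoly R[i][n.+1 + n.+1]}.
have [|c [c0 relc]] := relT0 (fun i => B i \mPo Phi).
  move=> i; apply: dhomog_comp; first exact: dhomog_lin_subst.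
  by move=> j; rewrite tnth_mktuple -[2%N]/(1 + 1)%N; apply: dhomogM; apply: dhomog_Xi.
pose F := \sum_t c t *: \prod_(i < (n.+1 + n.+1).+1) B i ^+ expo t i.
have compF N' (h : (n.+1 * n.+1).-tuple {mpoly R[i][N']}) : F \mPo h =
    \sum_t c t *: \prod_(i < (n.+1 + n.+1).+1) (B i \mPo h) ^+ expo t i.
  rewrite linear_sum; apply: eq_bigr => t _ /=; rewrite comp_mpolyZ rmorph_prod.
  by congr (_ *: _); apply: eq_bigr => i _; rewrite rmorphXn.
have [||u hu] := @rank_one_ideal _ _ _ _ (@mxvec_row n.+1) (@mxvec_col n.+1)
  (det_form R n.+1) (cofactor (generic_mx R n.+1)) F.
- by move=> i j k l; apply: cofactor_minor.
- by rewrite compF; apply: relc.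
exists c, (lin_subst g u); split=> //.
rewrite -[RHS](rmorphM (comp_mpoly _)) /= -hu.
have -> : [tuple cofactor (generic_mx R n.+1) (mxvec_row j) (mxvec_col j)
    | j < n.+1 * n.+1] = grad_tuple (det_form R n.+1).
  by apply: eq_from_tnth => j; rewrite !tnth_mktuple mderiv_det_form.
rewrite compF linear_sum; apply: eq_bigr => t _ /=.
rewrite comp_mpolyZ rmorph_prod; congr (_ *: _); apply: eq_bigr => i _.
by rewrite rmorphXn comp_grad_lin_subst.
Qed.

(** * Passing to the orbit closure *)

Section FormCoordinates.
Variables (R : realType) (N d : nat).
Local Notation C := R[i].
Local Notation D := #|{: monomial N d}|.

Definition form_of (q : 'rV[C]_D) : {mpoly C[N]} :=
  \sum_(i < D) q 0 i *: 'X_[val (val (enum_val i))].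

Lemma form_coordsK Q : Q \is d.-homog -> form_of (form_coords d Q) = Q.
Proof.
move=> hQ; apply/mpolyP => m; rewrite raddf_sum /=.
under eq_bigr => i _ do rewrite mcoeffZ mcoeffX mxE.
have [md|md] := eqVneq (mdeg m) d; last first.
  rewrite (dhomog_coeff0 hQ md) big1 // => i _.
  case: eqP => [e|]; last by rewrite mulr0.
  by case/eqP: md; rewrite -e; apply/eqP/(valP (enum_val i)).
have lt_m : (mdeg m < d.+1)%N by rewrite md.
have md' : mdeg (val (BMultinom lt_m)) == d by apply/eqP.
pose u : monomial N d := Sub (BMultinom lt_m) md'.
rewrite (bigD1 (enum_rank u)) //= enum_rankK SubK eqxx mulr1 big1 ?addr0 // => i iu.
case: eqP => [e|]; last by rewrite mulr0.
case/eqP: iu; rewrite -[LHS]enum_valK; congr enum_rank.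
by apply/val_inj/val_inj; rewrite SubK.
Qed.

Lemma poly_fam_form_of : poly_fam form_of.
Proof.
apply: poly_fam_sum => i; apply: poly_famZ; first exact: poly_fun_coord.
exact: poly_fam_const.
Qed.

End FormCoordinates.

Lemma comp_dhomog_scale (K : comNzRingType) a b (p : {mpoly K[a]})
    (t u : a.-tuple {mpoly K[b]}) d c :
  p \is d.-homog -> (forall i, tnth u i = c *: tnth t i) ->
  p \mPo u = c ^+ d *: (p \mPo t).
Proof.
move=> hp ut; rewrite !comp_mpolyEX scaler_sumr big_seq [RHS]big_seq.
apply: eq_bigr => m /(dhomog_mdeg hp) md; rewrite scalerA mulrC -scalerA.
congr (_ *: _); rewrite !comp_mpolyX -md mdegE -prodrXr -scaler_prod.
by apply: eq_bigr => i _; rewrite ut exprZn.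
Qed.

(** Scaling [g] by an [n]-th root of [t] multiplies the form by [t]. This is the stability that
    [mpoly_dependent_closed] asks for. *)
Lemma det_orbit_scale (R : realType) n (w : 'rV[R[i]]_#|{: monomial (n * n) n}|) t :
  (0 < n)%N -> det_orbit w -> t != 0 -> det_orbit (t *: w).
Proof.
move=> n0 [g gU <-] t0; pose r := n.-root t.
have rn : r ^+ n = t by apply: rootCK.
exists (r *: g).
  by rewrite /= unitmxZ // unitfE; apply: contraNneq t0 => r0; rewrite -rn r0 expr0n gtn_eqF.
have -> : lin_subst (r *: g) (det_form R n) = t *: lin_subst g (det_form R n).
  rewrite -rn; apply: comp_dhomog_scale (det_form_homog R n) _ => i.
  rewrite !tnth_mktuple /lin_form scaler_sumr; apply: eq_bigr => j _.
  by rewrite !mxE scalerA.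
by apply/rowP => j; rewrite !mxE mcoeffZ.
Qed.

(** Degrees add over an integral domain. The bound keeps the quotient in a divisibility relation
    inside a fixed finite-dimensional space. *)
Lemma dhomog_msize_factor (K : idomainType) N (p q : {mpoly K[N]}) s :
  q * p \is s.-homog -> q * p != 0 -> (msize q <= s.+1)%N.
Proof.
move=> h qp0; have := qp0; rewrite mulf_eq0 negb_or => /andP[q0 p0].
have <- : (mdeg (mlead (q * p))).+1 = s.+1.
  by rewrite (dhomog_mdeg h (mlead_supp qp0)).
rewrite mlead_deg // msizeM // (mpolySpred mdeg p0) addnS /=.
exact: leq_addr.
Qed.

Section LimitRelation.
Variables (R : realType) (n e T0 : nat).
Local Notation C := R[i].
Local Notation T := {ffun 'I_(n + n) -> 'I_T0.+1}.
Variable b : nat -> {mpoly C[n * n]}.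
Hypothesis n_gt0 : (0 < n)%N.
Hypothesis hb : forall i, b i \is e.-homog.
Hypothesis relT0 : forall g : 'M[C]_(n * n),
  exists (c : T -> C) (u : {mpoly C[n * n]}), (exists t, c t != 0) /\
    \sum_t c t *: \prod_(i < (n + n).+1)
      (b i \mPo grad_tuple (lin_subst g (det_form R n))) ^+ expo t i =
    u * lin_subst g (det_form R n).

Let s := (e * n.-1 * ((n + n) * T0))%N.
Local Notation I := (T + bmultinom (n * n) s.+1)%type.

Let polar (Q : {mpoly C[n * n]}) (t : T) : {mpoly C[n * n]} :=
  \prod_(i < (n + n).+1) (b i \mPo grad_tuple Q) ^+ expo t i.

(** For a nonzero form, dependence of this finite family says that a nontrivial combination of the
    polar products is divisible by the form, with a quotient of degree at most [s]. *)
Let rows (x : I) (q : 'rV[C]_#|{: monomial (n * n) n}|) : {mpoly C[n * n]} :=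
  match x with
  | inl t => polar (form_of q) t
  | inr m => 'X_[m] * form_of q
  end.

Lemma polar_homog Q t : Q \is n.-homog -> polar Q t \is s.-homog.
Proof.
move=> hQ; rewrite /s -(sum_expo t) big_distrr.
apply: dhomog_bigprod => i; apply: dhomogMn; apply: dhomog_comp => // j.
by rewrite tnth_mktuple; apply: dhomog_mderiv.
Qed.

Lemma rows_dependent w : det_orbit w -> mpoly_dependent (rows^~ w).
Proof.
case=> g _ <-; have [c [u [[t0 ct0] rel]]] := relT0 g.
have hQ : lin_subst g (det_form R n) \is n.-homog.
  exact/dhomog_lin_subst/det_form_homog.
set Q := lin_subst g _ in rel hQ.
have [v sv relv] : exists2 v, (msize v <= s.+1)%N &
    \sum_t c t *: polar Q t = v * Q.
  (* The degree bound on [u] needs a nonzero product; otherwise 0 serves as quotient. *)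
  have [uQ0|uQ0] := eqVneq (u * Q) 0.
    by exists 0; [rewrite msize0|rewrite mul0r -[RHS]uQ0 -rel].
  exists u => //; apply: dhomog_msize_factor uQ0; rewrite -rel.
  by apply: rpred_sum => t _; apply: dhomogZ; apply: polar_homog.
exists (fun x : I => match x with inl t => c t | inr m => - v@_m end).
split; first by exists (inl t0).
rewrite big_sumType /= form_coordsK // relv {1}(mpolywE sv) mulr_suml -big_split.
by apply: big1 => m _; rewrite /= scaleNr scalerAl subrr.
Qed.

Lemma limit_relation Q : Q \is n.-homog ->
  pclosure (@det_orbit R n) (form_coords n Q) ->
  exists (c : T -> C) (u : {mpoly C[n * n]}), (exists t, c t != 0) /\
    \sum_t c t *: polar Q t = u * Q.
Proof.
move=> hQ cl; have Q0 : Q != 0.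
  case: cl => + _; apply: contraNneq => ->; apply/eqP/rowP => i.
  by rewrite !mxE mcoeff0.
have [||c [[x0 cx0]]] := mpoly_dependent_closed _ _ rows_dependent cl.
- by move=> w t; apply: det_orbit_scale.
- case=> [t|m].
    apply: poly_fam_prod => i; apply: poly_famX; apply: poly_fam_comp => j.
    exact/poly_fam_deriv/poly_fam_form_of.
  by apply: poly_famM; [apply: poly_fam_const|apply: poly_fam_form_of].
rewrite big_sumType /= form_coordsK // => rel.
pose v : {mpoly C[n * n]} := \sum_(m : bmultinom (n * n) s.+1) c (inr m) *: 'X_[m].
exists (fun t => c (inl t)), (- v); split; last first.
  apply/eqP; rewrite mulNr -addr_eq0 -[X in _ == X]rel mulr_suml.
  by apply/eqP; congr (_ + _); apply: eq_bigr => m _; rewrite scalerAl.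
(* If the polar products all had coefficient zero, the relation would read [v * Q = 0] with [Q]
   nonzero, and every coefficient would vanish. *)
have [//|no] := pselect (exists t, c (inl t) != 0).
have c0 t : c (inl t) = 0 by apply/eqP/negPn/negP => ct; case: no; exists t.
have v0 : v = 0.
  apply/eqP; have : v * Q == 0.
    rewrite -[X in _ == X]rel [X in _ == X + _]big1 ?add0r => [|t _]; last first.
      by rewrite c0 scale0r.
    by rewrite mulr_suml; apply/eqP/eq_bigr => m _; rewrite scalerAl.
  by rewrite mulf_eq0 (negPf Q0) orbF.
case: x0 cx0 => [t|m]; first by rewrite c0 eqxx.
have := congr1 (mcoeff m) v0; rewrite mcoeff0 raddf_sum (bigD1 m) //= big1.
  by rewrite mcoeffZ mcoeffX eqxx mulr1 addr0 => ->; rewrite eqxx.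
by move=> m' mm; rewrite mcoeffZ mcoeffX -bmeqP (negPf mm) mulr0.
Qed.

End LimitRelation.

(** * Restriction of a padded form to the slice [l = 1] *)

Section Padding.
Variables (R : realType) (M N k : nat).
Local Notation C := R[i].
Variables (l : 'rV[C]_N) (A : 'M[C]_(M, N)) (P : {mpoly C[M]}).

(** A right inverse of the stacked matrix prescribes the values of [l] and of the rows of [A] at
    once. For [k = 0] the power of [l] is the constant 1, and a right inverse of [A] suffices. *)
Lemma padding_section :
  (if k == 0%N then row_free A else row_free (col_mx l A)) ->
  exists2 A' : 'M[C]_(N, M), A *m A' = 1%:M &
    forall x, exists2 v, v *m A^T = x & eval_at (lin_form l ^+ k) v = 1.
Proof.
case: eqP => [->|_] free.
  exists (pinvmx A); first exact: mulmxVp.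
  move=> x; exists (x *m (pinvmx A)^T); last by rewrite /eval_at expr0 meval1.
  by rewrite -mulmxA -trmx_mul mulmxVp // trmx1 mulmx1.
have inv := mulmxVp free; exists (rsubmx (pinvmx (col_mx l A))).
  have := congr1 drsubmx inv; rewrite -{1}(hsubmxK (pinvmx _)) mul_col_row.
  by rewrite block_mxKdr scalar_mx_block block_mxKdr.
move=> x; pose v := row_mx 1%:M x *m (pinvmx (col_mx l A))^T.
have : v *m (col_mx l A)^T = row_mx 1%:M x.
  by rewrite -mulmxA -trmx_mul inv trmx1 mulmx1.
rewrite tr_col_mx mul_mx_row => /eq_row_mx[vl vA]; exists v => //.
rewrite /eval_at rmorphXn /= -/(eval_at _ _) eval_lin_form vl.
by rewrite mxE eqxx expr1n.
Qed.

(** In the product rule, the term with the derivative of the power of [l] carries the factor [P],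
    zero at this point. *)
Lemma grad_padding v : eval_at P (v *m A^T) = 0 ->
  eval_at (lin_form l ^+ k) v = 1 ->
  gradient (lin_form l ^+ k * lin_subst A P) v = gradient P (v *m A^T) *m A.
Proof.
move=> Pv lv; apply/rowP => j; rewrite !mxE mderivM /eval_at mevalD !mevalM.
rewrite -!/(eval_at _ _) lv eval_lin_subst Pv mulr0 add0r mul1r.
rewrite mderiv_lin_subst /eval_at raddf_sum; apply: eq_bigr => i _ /=.
by rewrite mevalZ -/(eval_at _ _) eval_lin_subst mxE mulrC.
Qed.

End Padding.

Lemma dual_chain_bound (R : realType) (M m n d : nat) (P : {mpoly R[i][M]}) :
  (1 <= m)%N -> P \is m.-homog -> border_det_size m P n ->
  irreducible_chain (dual_variety P) d -> (d < n + n)%N.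
Proof.
move=> m1 hP [mn [Q [l [A [free defQ]]] cl]] chain.
have [//|nd] := ltnP d (n + n).
have n0 : (0 < n)%N := leq_trans m1 mn.
have [e [b [hb indep]]] := chain_forms chain nd.
have [A' AA' secA] : exists2 A' : 'M[R[i]]_(n * n, M), A *m A' = 1%:M &
    forall x, exists2 v, v *m A^T = x & eval_at (lin_form l ^+ (n - m)) v = 1.
  apply: padding_section; rewrite subn_eq0; move: free.
  by rewrite eqn_leq mn andbT.
have hQ : Q \is n.-homog.
  rewrite defQ -[X in X.-homog](subnK mn); apply: dhomogM.
    by rewrite -[X in X.-homog]mul1n; apply: dhomogMn; apply: dhomog_lin_form.
  exact: dhomog_lin_subst.
(* As [A *m A'] is the identity, [b' i] at [y *m A] equals [b i] at [y]; this undoes the factor [A]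
   in [grad_padding]. *)
pose b' i := lin_subst A'^T (b i).
have hb' i : b' i \is e.-homog by apply: dhomog_lin_subst.
have [T0 rel] := @det_orbit_relation R n e n0.
have [c [u [c0 relQ]]] := limit_relation n0 hb' (fun g => rel b' g hb') hQ cl.
pose H : {mpoly R[i][M]} := \sum_t c t *: \prod_(i < (n + n).+1) b i ^+ expo t i.
have hH : H \is (e * ((n + n) * T0))%N.-homog.
  apply: rpred_sum => t _; apply: dhomogZ; rewrite -(sum_expo t) big_distrr.
  by apply: dhomog_bigprod => i; apply: dhomogMn.
have evH y : eval_at H y =
    \sum_t c t * \prod_(i < (n + n).+1) eval_at (b i) y ^+ expo t i.
  rewrite /eval_at raddf_sum; apply: eq_bigr => t _ /=.
  rewrite mevalZ rmorph_prod; congr (_ * _); apply: eq_bigr => i _.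
  by rewrite rmorphXn.
have [w [_ dual_w]] := indep _ c (@expo (n + n) T0) _ (@sum_expo _ _) (@expo_inj _ _) c0.
(* [w] lies in the closure of the tangent hyperplanes, so it is enough that the form [H] vanish on
   these. *)
rewrite -evH; case/eqP; apply: (dual_w _ _ hH).
move=> _ [x [_ Px _ [a _ ->]]]; rewrite (eval_at_scale _ _ hH).
suff -> : eval_at H (gradient P x) = 0 by rewrite mulr0.
have [v vx lv] := secA x; rewrite -{}vx in Px *.
have gradQ : gradient Q v = gradient P (v *m A^T) *m A by rewrite defQ grad_padding.
(* At [v], a zero of [Q], the right side of the relation vanishes. *)
have := congr1 (fun F => eval_at F v) relQ; rewrite {2}/eval_at mevalM.
rewrite [X in _ = _ * X -> _](_ : _ = 0); last first.
  by rewrite defQ mevalM -!/(eval_at _ _) eval_lin_subst Px mulr0.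
rewrite mulr0 => relv; rewrite -[RHS]relv evH /eval_at raddf_sum; apply: eq_bigr => t _ /=.
rewrite mevalZ rmorph_prod; congr (_ * _); apply: eq_bigr => i _.
rewrite rmorphXn /= comp_mpoly_meval; congr (_ ^+ _).
have -> : (b' i).@[fun j => (tnth (grad_tuple Q) j).@[v 0]] =
    eval_at (b' i) (gradient Q v).
  by apply: meval_eq => j; rewrite tnth_mktuple mxE.
by rewrite eval_lin_subst trmxK gradQ -mulmxA AA' mulmx1.
Qed.

Local Open Scope ereal_scope.

Theorem theorem1p0p3 (R : realType) (M m : nat) (P : {mpoly R[i][M]})
    (m_ge1 : (1 <= m)%N) (P_homog : P \is m.-homog)
    (P_irr : irreducible_mpoly P) :
  (pdim (dual_variety P) + 1) / 2%:E <= border_dc m P.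
Proof.
apply: le_ereal_inf_tmp => _ [n dcn <-].
rewrite inver pnatr_eq0 /= lee_pdivrMr ?ltr0n // -EFinM -natrM.
(* This reduces the claim to [pdim <= 2n - 1], checked on each chain length; it covers an empty dual
   variety, where [pdim] is minus infinity. *)
have -> : (n * 2)%:R%:E = (n * 2)%:R%:E - 1%:E + 1%:E :> \bar R.
  by rewrite -EFinB -EFinD subrK.
apply: leeD => //; apply: ge_ereal_sup => _ [d chain <-].
have dn := dual_chain_bound m_ge1 P_homog dcn chain.
rewrite -EFinB lee_fin lerBrDr natr1 ler_nat; lia.
Qed.
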